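(* Let $k$ be an integer and let $G_1,\dots,G_t$ be connected graphs with $\mathrm{sipc}(G_i)\le k$ for all $i\in\{1,\dots,t\}$. Let $G$ be any graph obtained from $G_1,\dots,G_t$ by taking pairwise clique-sums, i.e., starting from the collection $\{G_1,\dots,G_t\}$ and repeatedly replacing two graphs of the current collection by a clique-sum of them, until a single graph $G$ remains. Then $\mathrm{sipc}(G)\le 3k+18$.
   Context: If graphs $A$ and $B$ contain cliques $C_A$ and $C_B$ of the same (positive) size, a clique-sum of $A$ and $B$ is obtained from the disjoint union of $A$ and $B$ by identifying the vertices of $C_A$ with those of $C_B$ via a bijection, forming a single shared clique (no edges are deleted). An isometric path is a shortest path; it is $v$-rooted if $v$ is an end-vertex. For connected $G$ and $v\in V(G)$, $\mathrm{ipc}_v(G)$ is the minimum $k$ such that the vertices of every isometric path of $G$ can be covered by $k$ many $v$-rooted isometric paths; $\mathrm{sipc}(G)=\max_{v\in V(G)}\mathrm{ipc}_v(G)$. *)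

(* Defs.v *)
From mathcomp Require Import all_boot all_algebra.
From mathcomp Require Import boolp.

Set Implicit Arguments.
Unset Strict Implicit.
Unset Printing Implicit Defensive.

(* Finite simple graphs. *)
Record sgraph := SGraph {
  vertex :> finType;
  adj : rel vertex;
  adj_sym : symmetric adj;
  adj_irrefl : irreflexive adj
}.

Definition graph_connected (G : sgraph) : Prop :=
  0 < #|G| /\ forall x y : G, connect (@adj G) x y.

Definition clique (G : sgraph) (C : {set G}) : Prop :=
  {in C &, forall x y, x != y -> adj x y}.

(* A path is the sequence of its vertices, of which there is at least one. *)
Definition path_between (G : sgraph) (x y : G) (s : seq G) : bool :=
  if s is z :: p then [&& z == x, path (@adj G) z p, uniq s & last z p == y]
  else false.

Definition shortest_path (G : sgraph) (x y : G) (s : seq G) : Prop :=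
  path_between x y s /\
  forall s', path_between x y s' -> size s <= size s'.

Definition isometric_path (G : sgraph) (s : seq G) : Prop :=
  exists x y, shortest_path x y s.

Definition rooted_isometric_path (G : sgraph) (v : G) (s : seq G) : Prop :=
  exists x y, shortest_path x y s /\ (v = x \/ v = y).

Definition rooted_coverable (G : sgraph) (v : G) (k : nat) : Prop :=
  forall P : seq G, isometric_path P ->
    exists Q : 'I_k -> seq G,
      (forall i, rooted_isometric_path v (Q i)) /\
      (forall x, x \in P -> exists i, x \in Q i).

(* The value 0 is never used for a connected graph: see [ipcP]. *)
Definition ipc (G : sgraph) (v : G) : nat :=
  if pselect (exists k, `[< rooted_coverable v k >]) is left ex
  then ex_minn ex else 0.

Definition sipc (G : sgraph) : nat := \max_(v : G) ipc v.

Definition disjoint_adj (A B : sgraph) : rel (A + B) := fun z w =>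
  match z, w with
  | inl a, inl a' => adj a a'
  | inr b, inr b' => adj b b'
  | _, _ => false
  end.

Definition identified (A B : sgraph) (CA : {set A}) (phi : A -> B)
    (z w : A + B) : Prop :=
  match z, w with
  | inl a, inr b | inr b, inl a => a \in CA /\ b = phi a
  | _, _ => z = w
  end.

(* [G] is, up to isomorphism, the quotient of the disjoint union of [A] and [B]
   by the identification of each [a] in [CA] with [phi a] in [CB]; [q] is the
   quotient map.  Only the restriction of [phi] to [CA] matters. *)
Definition clique_sum (A B G : sgraph) : Prop :=
  exists (CA : {set A}) (CB : {set B}) (phi : A -> B) (q : A + B -> G),
    [/\ clique CA, clique CB & 0 < #|CA|] /\
    [/\ {in CA &, injective phi} & phi @: CA = CB] /\
    [/\ forall u, exists z, q z = u,
        forall z w, q z = q w <-> identified CA phi z w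
      & forall u v, adj u v <->
          exists z w, [/\ q z = u, q w = v & disjoint_adj z w]].

(* The collection is a list, with repetitions allowed. [clique_sum] is symmetric
   in its first two arguments, so the order in which the two summands are listed
   is irrelevant. *)
Inductive iterated_clique_sum : seq sgraph -> sgraph -> Prop :=
| ics_single G : iterated_clique_sum [:: G] G
| ics_step s1 A s2 B s3 C G :
    clique_sum A B C ->
    iterated_clique_sum (C :: s1 ++ s2 ++ s3) G ->
    iterated_clique_sum (s1 ++ A :: s2 ++ B :: s3) G.

Lemma shortest_path_exists (G : sgraph) (x y : G) :
  connect (@adj G) x y -> exists s, shortest_path x y s.
Proof.
case/connectP=> p0 /shortenP[p xp up _ ylast].
have ex : exists n, `[< exists s, path_between x y s /\ size s = n >].
  exists (size (x :: p)); apply/asboolP; exists (x :: p).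
  by split=> //; rewrite /path_between eqxx xp up ylast eqxx.
case: (ex_minnP ex) => n /asboolP[s [xys <-]] smin.
exists s; split=> // s' xys'; apply: smin.
by apply/asboolP; exists s'.
Qed.

Lemma ipcP (G : sgraph) (v : G) : graph_connected G ->
  rooted_coverable v (ipc v) /\
  forall k, rooted_coverable v k -> ipc v <= k.
Proof.
move=> [_ Gc]; rewrite /ipc; case: pselect => [ex|[]].
  case: (ex_minnP ex) => n /asboolP nP nmin.
  by split=> // k kP; apply: nmin; apply/asboolP.
have /choice [Q QP] : forall i : 'I_#|G|, exists s,
    shortest_path v (enum_val i) s.
  by move=> i; apply: shortest_path_exists.
exists #|G|; apply/asboolP=> P _; exists Q; split=> [i|x _].
  by exists v, (enum_val i); split; [apply: QP | left].
exists (enum_rank x); have := QP (enum_rank x); rewrite enum_rankK.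
case; case: (Q _) => // z p /and4P[_ _ _ /eqP<-] _; exact: mem_last.
Qed.

Lemma clique_sum_connected (A B G : sgraph) : clique_sum A B G ->
  graph_connected A -> graph_connected B -> graph_connected G.
Proof.
move=> [CA [CB [phi [q]]]] [[_ _ /card_gt0P[c cCA]] [_ [qs qi qe]]].
move=> [_ Ac] [_ Bc].
have symG : connect_sym (@adj G) by apply/sym_connect_sym/adj_sym.
have qA a : connect (@adj G) (q (inl c)) (q (inl a)).
  have /connectP[p cp ->] := Ac c a.
  elim: p c {cCA} cp => //= b p IHp c /andP[cb bp].
  apply: connect_trans (IHp _ bp); apply/connect1/qe.
  by exists (inl c), (inl b).
have qB b : connect (@adj G) (q (inl c)) (q (inr b)).
  have -> : q (inl c) = q (inr (phi c)) by apply/qi.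
  have /connectP[p cp ->] := Bc (phi c) b.
  elim: p (phi c) cp => //= d p IHp e /andP[ed dp].
  apply: connect_trans (IHp _ dp); apply/connect1/qe.
  by exists (inr e), (inr d).
have qall u : connect (@adj G) (q (inl c)) u.
  by have [[a|b] <-] := qs u.
split; first by apply/card_gt0P; exists (q (inl c)).
by move=> x y; apply: connect_trans (qall y); rewrite symG.
Qed.

(* Main.v *)
(** A graph glued along cliques is a tree of the pieces [G_i], any two of which
    are separated by shared cliques. Given a root [v] and a geodesic [P] from [x]
    to [y], let [M] be the piece that is the median of [v], [x] and [y] in this
    tree. A vertex of [P] outside [M] lies in a branch at [M] that is cut off by
    a clique and avoids two of [v], [x], [y]. It cannot avoid both [x] and [y],
    as [P] would cross the clique twice. The vertices whose branch avoids [v] and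
    [x] have the property that the distance to [v] grows along [P] with a total
    defect of at most 2, so they are split by defect into three subsets, each on
    a [v]-rooted geodesic; the same holds for [y] instead of [x]. What is left of
    [P] is a geodesic of [M], covered by [k] geodesics rooted at a vertex [c] of
    the clique separating [v] from [M], chosen nearest to [v]. Along each of
    these the defect is at most 1, so two [v]-rooted geodesics cover its part in
    [M]. This gives the bound [2k + 6]. Pieces remain isometric in clique-sums,
    and the existence of medians is preserved by them once it is stated for
    triples of cliques: a clique on the other side is replaced by the shared
    one. *)

Require Import Defs.
From mathcomp Require Import all_boot all_algebra.
From mathcomp Require Import boolp zify.

Set Implicit Arguments.
Unset Strict Implicit.
Unset Printing Implicit Defensive.

(** * Graph distance and geodesics *)

Section Distance.
Variable G : sgraph.
Implicit Types (x y z : G) (p : seq G).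

(* On disconnected pairs the value is [#|G|]. *)
Definition dist x y : nat :=
  find (fun n => [exists p : n.-tuple G,
                    path (@adj G) x p && (last x p == y)]) (iota 0 #|G|).

Definition geo x p : bool := path (@adj G) x p && (size p == dist x (last x p)).

Lemma dist_le x p : path (@adj G) x p -> dist x (last x p) <= size p.
Proof.
move=> xp; rewrite /dist; set a := (X in find X _).
have [ltpG|] := ltnP (size p) #|G|; last first.
  by apply: leq_trans; rewrite -{2}(size_iota 0 #|G|) find_size.
rewrite leqNgt; apply/negP => /(before_find 0).
rewrite nth_iota // add0n => /existsP[].
by exists (in_tuple p); rewrite xp eqxx.
Qed.

Hypothesis Gc : graph_connected G.

Lemma geo_exists x y : exists2 p, geo x p & last x p = y.
Proof.
suff [p xp [lp sp]] : exists2 p, path (@adj G) x p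
    & last x p = y /\ size p = dist x y.
  by exists p; rewrite // /geo xp lp sp eqxx.
rewrite /dist; set a := (X in find X _).
have ha : has a (iota 0 #|G|).
  case/connectP: (Gc.2 x y) => p0 /shortenP[p xp up _ ylast].
  apply/hasP; exists (size p).
    by rewrite mem_iota /= add0n -[(size p).+1]/(size (x :: p)) -(card_uniqP up)
               max_card.
  by apply/existsP; exists (in_tuple p); rewrite xp ylast eqxx.
have ltG : find a (iota 0 #|G|) < #|G| by move: ha; rewrite has_find size_iota.
have := nth_find 0 ha; rewrite nth_iota // add0n => /existsP[p /andP[xp /eqP lp]].
by exists (val p); rewrite // size_tuple.
Qed.

Lemma dist_self x : dist x x = 0.
Proof. by apply/eqP; rewrite -leqn0 (@dist_le x [::]). Qed.

Lemma dist_adj x y : adj x y -> dist x y <= 1.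
Proof. by move=> xy; apply: (@dist_le x [:: y]); rewrite /= xy. Qed.

Lemma dist_clique (C : {set G}) : clique C -> {in C &, forall x y, dist x y <= 1}.
Proof.
move=> cC x y xC yC; have [->|nxy] := eqVneq x y; first by rewrite dist_self.
exact/dist_adj/cC.
Qed.

Lemma dist_triangle x y z : dist x z <= dist x y + dist y z.
Proof.
have [p /andP[xp /eqP sp] lp] := geo_exists x y.
have [q /andP[yq /eqP sq] lq] := geo_exists y z.
have {1}-> : z = last x (p ++ q) by rewrite last_cat lp.
by rewrite -lp -sp lp -lq -sq -size_cat; apply: dist_le; rewrite cat_path xp lp.
Qed.

Lemma path_rev x p :
  path (@adj G) x p -> path (@adj G) (last x p) (rev (belast x p)).
Proof.
by move=> xp; rewrite rev_path (@eq_path _ _ (@adj G)) // => a b; apply: adj_sym.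
Qed.

Lemma last_rev_belast x p : last (last x p) (rev (belast x p)) = x.
Proof. by case: p => //= z p; rewrite rev_cons last_rcons. Qed.

Lemma dist_sym x y : dist x y = dist y x.
Proof.
wlog: x y / dist y x <= dist x y => [le_sym|].
  by have [/le_sym|/ltnW/le_sym->] := leqP (dist y x) (dist x y).
move=> le_yx; apply/eqP; rewrite eqn_leq le_yx andbT.
have [p /andP[yp /eqP sp] lp] := geo_exists y x.
have := dist_le (path_rev yp).
by rewrite last_rev_belast size_rev size_belast sp lp.
Qed.

Lemma geo_nil x : geo x [::]. Proof. by rewrite /geo /= dist_self. Qed.

Section Geodesic.
Variables (x : G) (p : seq G).
Hypothesis gp : geo x p.
Let P i := nth x (x :: p) i.

(** [p] omits the starting vertex, so [drop i p] begins at [P i.+1], and [P i :: segment i j] is the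
    subpath from [P i] to [P j]. *)
Definition segment i j := take (j - i) (drop i p).

Lemma segmentP i j : i <= j <= size p ->
  [/\ path (@adj G) (P i) (segment i j), last (P i) (segment i j) = P j,
      size (segment i j) = j - i
    & forall l, l <= j - i -> nth x (P i :: segment i j) l = P (i + l)].
Proof.
case/andP=> ij jp; have /andP[xp _] := gp.
have sz : size (segment i j) = j - i.
  by rewrite size_take_min size_drop; lia.
have nthE l : l <= j - i -> nth x (P i :: segment i j) l = P (i + l).
  case: l => [|l] lji; first by rewrite addn0.
  by rewrite /= nth_take // nth_drop addnS.
split=> //; last first.
  by rewrite (last_nth x) sz nthE // subnKC.
apply/(pathP x) => l; rewrite sz => lji.
rewrite -[nth x (segment i j) l]/(nth x (P i :: segment i j) l.+1)
  !nthE ?(ltnW lji) //.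
rewrite addnS; apply: (pathP x _) => //; lia.
Qed.

(** The subpaths bound from above the distances between consecutive members of [P 0], [P i], [P j]
    and the last vertex. These bounds add up to the distance between the ends, so the triangle
    inequality makes each of them sharp. *)
Lemma dist_geo i j : i <= j <= size p -> dist (P i) (P j) = j - i.
Proof.
move=> /[dup] ijp /andP[ij jp]; have /andP[xp /eqP sp] := gp.
have [/dist_le + + + _] := segmentP ijp; move=> + lij sij; rewrite lij sij => le_ij.
have [/dist_le + + + _] := @segmentP 0 i ltac:(lia); move=> + l0i s0i.
rewrite l0i s0i subn0 => le_0i.
have [/dist_le + + + _] := @segmentP j (size p) ltac:(lia); move=> + ljp sjp.
rewrite ljp sjp => le_jp.
have lastp : last x p = P (size p) by rewrite (last_nth x).
have := dist_triangle (P 0) (P i) (P (size p)).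
have := dist_triangle (P i) (P j) (P (size p)).
by rewrite -{1}lastp -[P 0]/x -lastp -sp in le_0i le_jp *; lia.
Qed.

Lemma geo_segment i j : i <= j <= size p -> geo (P i) (segment i j).
Proof.
move=> ijp; have [pij lij sij _] := segmentP ijp.
by rewrite /geo pij lij sij dist_geo ?eqxx.
Qed.

Lemma mem_segment i j l : i <= l <= j -> j <= size p ->
  P l \in P i :: segment i j.
Proof.
move=> ilj jp; have [|_ _ sij /(_ (l - i))] := @segmentP i j; first lia.
rewrite subnKC; last lia; move=> <-; last lia.
by rewrite mem_nth //= sij; lia.
Qed.

Lemma segment_mem i j u : i <= j <= size p -> u \in P i :: segment i j ->
  exists2 l, i <= l <= j & u = P l.
Proof.
move=> ijp /(nthP x)[l]; have [_ _ /= -> nthE] := segmentP ijp.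
rewrite ltnS => lij; rewrite nthE // => <-; exists (i + l) => //; lia.
Qed.
End Geodesic.

Lemma geo_rev x p : geo x p -> geo (last x p) (rev (belast x p)).
Proof.
case/andP=> xp /eqP sp; apply/andP; split.
  exact: path_rev.
by rewrite size_rev size_belast sp dist_sym last_rev_belast.
Qed.

Lemma rev_geo x p : rev (x :: p) = last x p :: rev (belast x p).
Proof. by rewrite lastI rev_rcons. Qed.

End Distance.

(** * Coverings by rooted geodesics, and separation by cliques *)

Definition coverable (G : sgraph) (v : G) (k : nat) (X : {set G}) : Prop :=
  exists Q : seq (seq G), [/\ size Q <= k, all (geo v) Q
    & forall u, u \in X -> exists2 q, q \in Q & u \in v :: q].

(** The two sets may overlap, so lying strictly behind [K] is expressed by [u \in U] together with
    [u \notin K]. *)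
Definition barrier (G : sgraph) (K U : {set G}) : Prop :=
  clique K /\ forall a b, a \in U -> adj a b -> b \in U :|: K.

Section Cover.
Variable G : sgraph.
Hypothesis Gc : graph_connected G.
Implicit Types (v x y u w : G) (p q : seq G) (K U X Y M : {set G}).

Lemma coverableW v k m X Y :
  k <= m -> X \subset Y -> coverable v k Y -> coverable v m X.
Proof.
move=> km /subsetP XY [Q [sQ gQ cQ]]; exists Q; split=> //.
  exact: leq_trans km.
by move=> u /XY/cQ.
Qed.

Lemma coverable0 v : coverable v 0 set0.
Proof. by exists [::]; split=> // u; rewrite inE. Qed.

Lemma coverableU v k m X Y :
  coverable v k X -> coverable v m Y -> coverable v (k + m) (X :|: Y).
Proof.
move=> [Q [sQ gQ cQ]] [R [sR gR cR]]; exists (Q ++ R); split=> [||u].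
- by rewrite size_cat leq_add.
- by rewrite all_cat gQ.
by rewrite inE => /orP[/cQ|/cR] [q qQ uq]; exists q; rewrite // mem_cat qQ ?orbT.
Qed.

Lemma coverable_bigU (I : eqType) v m (s : seq I) (F : I -> {set G}) :
  (forall i, i \in s -> coverable v m (F i)) ->
  coverable v (m * size s) (\bigcup_(i <- s) F i).
Proof.
elim: s => [|i s IHs] Fs; first by rewrite big_nil muln0; apply: coverable0.
rewrite big_cons mulnS; apply: coverableU; first by apply: Fs; rewrite mem_head.
by apply: IHs => j js; apply: Fs; rewrite inE js orbT.
Qed.

(** On a geodesic the position of a vertex is its distance from the start, so later arguments order
    vertices by [dist x] instead of by index. *)
Lemma geo_index x p u : geo x p -> u \in x :: p ->
  dist x u <= size p /\ nth x (x :: p) (dist x u) = u.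
Proof.
move=> gp /(nthP x)[i]; rewrite /= ltnS => ip <-.
by have := dist_geo Gc gp (i := 0) (j := i); rewrite /= subn0 => ->.
Qed.

Lemma geo_dist x p u w : geo x p -> u \in x :: p -> w \in x :: p ->
  dist x u <= dist x w -> dist u w = dist x w - dist x u.
Proof.
move=> gp up wp le_uw; have [_ {1}<-] := geo_index gp up.
have [lw {1}<-] := geo_index gp wp.
by apply: dist_geo => //; rewrite le_uw.
Qed.

(** With the triangle inequality, the condition makes [dist v] grow on [X] by exactly the distance
    travelled along [p]. Hence a geodesic from [v] to the first vertex of [X], continued along [p]
    to the last one, is still a geodesic. *)
Lemma chain_coverable1 v x p X : geo x p -> {subset X <= x :: p} ->
  {in X &, forall u w, dist x u <= dist x w ->
     dist v u + dist x w <= dist v w + dist x u} ->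
  coverable v 1 X.
Proof.
move=> gp Xp mono; have [->|[u0 u0X]] := set_0Vmem X.
  exact: coverableW (sub0set _) (coverable0 v).
case: (arg_minnP (dist x) u0X) => u uX umin.
case: (arg_maxnP (dist x) u0X) => w wX wmax.
have [up wp] := (Xp _ uX, Xp _ wX).
have [[lu Pu] [lw Pw]] := (geo_index gp up, geo_index gp wp).
have uw : dist x u <= dist x w := wmax _ uX; have duw := geo_dist gp up wp uw.
have [q /andP[vq /eqP sq] lq] := geo_exists Gc v u.
have ijp : dist x u <= dist x w <= size p by rewrite uw.
have := segmentP gp ijp; rewrite Pu Pw; move=> [ur lr sr _].
exists [:: q ++ segment p (dist x u) (dist x w)]; split=> //.
  rewrite /= andbT /geo cat_path last_cat lq vq ur lr size_cat sq sr lq.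
  have := mono _ _ uX wX uw; have := dist_triangle Gc v u w; rewrite duw.
  by move/andP: ijp => [? ?] ? ?; apply/eqP; lia.
move=> z zX; exists (q ++ segment p (dist x u) (dist x w)); rewrite ?mem_head //.
have [_ Pz] := geo_index gp (Xp _ zX).
have := mem_segment gp (i := dist x u) (j := dist x w) (l := dist x z).
rewrite Pz Pu umin // [_ <= dist x w]wmax // => /(_ isT lw).
rewrite -cat_cons mem_cat inE => /orP[/eqP->|->]; last by rewrite orbT.
by rewrite -lq mem_last.
Qed.

(** Relative to the first vertex of [X], the defect of a vertex lies between 0, by the triangle
    inequality, and [D], by hypothesis. Vertices of equal defect have none relative to each other,
    so each of the [D.+1] level sets [F e] fits on one geodesic. *)
Lemma chain_coverable v x p X D : geo x p -> {subset X <= x :: p} ->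
  {in X &, forall u w, dist x u <= dist x w ->
     dist v u + dist x w <= dist v w + dist x u + D} ->
  coverable v D.+1 X.
Proof.
move=> gp Xp mono; have [->|[u0 u0X]] := set_0Vmem X.
  exact: coverableW (sub0set _) (coverable0 v).
case: (arg_minnP (dist x) u0X) => u uX umin.
pose F e := [set w in X | dist v w + dist x u + e == dist v u + dist x w].
apply: (@coverableW v (1 * size (iota 0 D.+1)) _ _ (\bigcup_(e <- iota 0 D.+1) F e)).
- by rewrite size_iota mul1n.
- apply/subsetP => w wX; have := mono _ _ uX wX (umin _ wX) => wD.
  have := dist_triangle Gc v u w; rewrite [dist u w](geo_dist gp) ?Xp ?umin // => wE.
  have le_uw := umin _ wX.
  have eD : (dist v u + dist x w) - (dist v w + dist x u) \in iota 0 D.+1.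
    by rewrite mem_iota; lia.
  rewrite (big_rem _ eD) /= inE; apply/orP; left; rewrite inE wX /=.
  by apply/eqP; lia.
apply: coverable_bigU => e _; apply: (chain_coverable1 gp) => [w|w z].
  by rewrite inE => /andP[/Xp].
by rewrite !inE => /andP[wX /eqP we] /andP[zX /eqP ze] _; lia.
Qed.

Lemma barrier_walk K U a p : barrier K U -> path (@adj G) a p ->
  a \in U :|: K -> last a p \notin U -> exists2 c, c \in a :: p & c \in K.
Proof.
move=> [_ bU]; elim: p a => [|b p IHp] a /=.
  by rewrite inE => _ /orP[->|aK _] //; exists a; rewrite ?mem_head.
case/andP=> ab bp; rewrite inE => /orP[aU|aK] lU; last by exists a; rewrite ?mem_head.
have [c cp cK] := IHp b bp (bU a b aU ab) lU.
by exists c; rewrite // inE cp orbT.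
Qed.

Lemma dist_barrier K U a b : barrier K U -> a \in U :|: K -> b \notin U ->
  exists2 c, c \in K & dist a b = dist a c + dist c b.
Proof.
move=> bKU aU bU; have [p gp lp] := geo_exists Gc a b.
have /andP[ap _] := gp; rewrite -lp in bU.
have [c cp cK] := barrier_walk bKU ap aU bU; exists c => //.
have lpp := mem_last a p; have [lc _] := geo_index gp cp.
have [_ /eqP sp] := andP gp.
have le_c : dist a c <= dist a (last a p) by rewrite -sp.
by rewrite -lp (geo_dist gp cp lpp) // subnKC.
Qed.

Lemma barrier_hit K U x p u w : barrier K U -> geo x p ->
  u \in x :: p -> w \in x :: p -> dist x u <= dist x w ->
  (u \in U :|: K) && (w \notin U) || (u \notin U) && (w \in U :|: K) ->
  exists c, [/\ c \in K, c \in x :: p & dist x u <= dist x c <= dist x w].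
Proof.
move=> bKU gp up wp uw cross.
have [[lu Pu] [lw Pw]] := (geo_index gp up, geo_index gp wp).
have ijp : dist x u <= dist x w <= size p by rewrite uw.
have := segmentP gp ijp; rewrite Pu Pw; move=> [ur lr _ _].
have [c cs cK] : exists2 c, c \in u :: segment p (dist x u) (dist x w) & c \in K.
  case/orP: cross => /andP[uU wU].
    by apply: (barrier_walk bKU ur) => //; rewrite lr.
  (* Entering [U] is leaving it along the reversed segment. *)
  have := barrier_walk bKU (path_rev ur).
  rewrite last_rev_belast lr => /(_ wU uU)[c cs cK]; exists c => //.
  by rewrite -mem_rev rev_geo lr.
have := segment_mem gp ijp; rewrite Pu => /(_ _ cs)[l lij cE].
have lp : l <= size p by case/andP: lij => _ /leq_trans; apply.
have := dist_geo Gc gp (i := 0) (j := l) lp; rewrite /= subn0 -cE => dl.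
by exists c; rewrite dl; split=> //; rewrite cE; apply: mem_nth.
Qed.

(** The path would meet [K] strictly before and strictly after [z], hence at two vertices at
    distance at least 2, which a clique does not have. *)
Lemma barrier_convex K U x p u z w : barrier K U -> geo x p ->
  u \in x :: p -> z \in x :: p -> w \in x :: p -> dist x u <= dist x z <= dist x w ->
  u \notin U -> z \in U -> z \notin K -> w \notin U -> False.
Proof.
move=> bKU gp up zp wp /andP[uz zw] uU zU zK wU.
have [|c [cK cp cb]] := barrier_hit bKU gp up zp uz.
  by rewrite uU !inE zU /= orbT.
have [|d [dK dp db]] := barrier_hit bKU gp zp wp zw.
  by rewrite wU !inE zU.
have neq_z e : e \in K -> e \in x :: p -> dist x e != dist x z.
  move=> eK ep; apply: contraNneq zK => eE; have [_ <-] := geo_index gp zp.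
  by rewrite -eE; have [_ ->] := geo_index gp ep.
have lt_cz : dist x c < dist x z by rewrite ltn_neqAle neq_z //; case/andP: cb.
have lt_zd : dist x z < dist x d by rewrite ltn_neqAle eq_sym neq_z //; case/andP: db.
have := dist_clique bKU.1 cK dK.
rewrite (geo_dist gp cp dp (ltnW (ltn_trans lt_cz lt_zd))).
by clear -lt_cz lt_zd; lia.
Qed.

(* The geodesic from [x] enters [U] through a vertex [c] of the clique [K], and
   cannot cross [K] again later. Hence a later vertex [w] is beyond [K] as seen
   from [v], and [dist v w] is, up to one for each of the two uses of a vertex
   of [K] other than [c], equal to [dist v c + dist c w]. *)
Lemma barrier_slack K U v x p u w : barrier K U -> geo x p ->
  u \in x :: p -> w \in x :: p -> dist x u <= dist x w ->
  u \in U -> u \notin K -> x \notin U -> v \notin U ->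
  dist v u + dist x w <= dist v w + dist x u + 2.
Proof.
move=> bKU gp up wp uw uU uK xU vU.
have xp : x \in x :: p by rewrite mem_head.
have [wU|wU] := boolP (w \in U); last first.
  case: (barrier_convex bKU gp xp up wp _ xU uU uK wU).
  by rewrite uw dist_self.
have [||c [cK cp cb]] := barrier_hit bKU gp xp up.
- by rewrite dist_self.
- by rewrite xU !inE uU /= orbT.
have wUK : w \in U :|: K by rewrite inE wU.
have [d dK] := dist_barrier bKU wUK vU.
rewrite dist_sym // [dist w d]dist_sym // [dist d v]dist_sym // => ->.
have cd := dist_clique bKU.1 cK dK; have dc := dist_clique bKU.1 dK cK.
have := dist_triangle Gc v d c; have := dist_triangle Gc c d w.
have := dist_triangle Gc v c u.
have /andP[_ le_cu] := cb.
rewrite (geo_dist gp cp wp (leq_trans le_cu uw)) (geo_dist gp cp up le_cu).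
by clear -cd dc le_cu uw; lia.
Qed.

(** [K] and [U] may vary with [u]: bounding the defect of a pair by 2 takes only the barrier of its
    earlier vertex. *)
Lemma branch_coverable v x p X : geo x p -> {subset X <= x :: p} ->
  (forall u, u \in X -> exists K U,
     [/\ barrier K U, u \in U, u \notin K, x \notin U & v \notin U]) ->
  coverable v 3 X.
Proof.
move=> gp Xp bX; apply: (chain_coverable gp Xp) => u w uX wX uw.
have [K [U [bKU uU uK xU vU]]] := bX u uX.
by apply: (barrier_slack bKU gp) => //; apply: Xp.
Qed.
End Cover.

(** * Pieces and medians *)

(** Only the covered geodesic has to stay inside [M]; the covering ones are geodesics of [G] and may
    leave it. *)
Definition piece (G : sgraph) (k : nat) (M : {set G}) : Prop :=
  forall c x p, c \in M -> geo x p -> {subset x :: p <= M} ->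
  coverable c k [set u in x :: p].

(* [M] plays the part of the bag, in a tree decomposition along the shared
   cliques, that is a median of bags containing the three cliques [K i]; [U] is
   the branch at [M] which contains [Q], cut off by [C]. *)
Definition median (G : sgraph) (k : nat) (K : 'I_3 -> {set G}) (M : {set G}) :
    Prop :=
  piece k M /\
  forall Q : {set G}, clique Q -> exists C U,
    [/\ barrier C U, C \subset M, Q \subset U :|: C, [disjoint U & M]
      & exists i0, forall i, i != i0 -> [disjoint U & K i]].

Definition has_medians (k : nat) (G : sgraph) : Prop :=
  forall K : 'I_3 -> {set G}, (forall i, clique (K i)) -> exists M, median k K M.

(** * From [ipc] to coverings and back *)

Section ShortestPaths.
Variable G : sgraph.
Hypothesis Gc : graph_connected G.
Implicit Types (v x y : G) (p : seq G).

Lemma geo_uniq x p : geo x p -> uniq (x :: p).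
Proof.
move=> gp; apply: (@map_uniq _ _ (dist x)).
suff -> : map (dist x) (x :: p) = iota 0 (size p).+1 by apply: iota_uniq.
apply: (@eq_from_nth _ 0) => [|i]; rewrite size_map ?size_iota //= ltnS => ip.
rewrite -[_ :: map _ _]/(map (dist x) (x :: p)) (nth_map x) //
  -[_ :: iota _ _]/(iota 0 _.+1).
rewrite nth_iota // (dist_geo Gc gp (i := 0) (j := i)) //; lia.
Qed.

Lemma geo_shortest x p : geo x p -> shortest_path x (last x p) (x :: p).
Proof.
move=> gp; have /andP[xp /eqP sp] := gp.
split=> [|[//|z q /and4P[/eqP-> zq _ /eqP lq]]].
  by rewrite /path_between eqxx xp geo_uniq /= ?eqxx.
by rewrite /= sp -lq ltnS dist_le.
Qed.

Lemma shortest_geo x y s : shortest_path x y s ->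
  exists p, [/\ s = x :: p, geo x p & last x p = y].
Proof.
case: s => [[]//|z p] [/and4P[/eqP-> xp _ /eqP lp] smin]; exists p; split=> //.
have [q gq lq] := geo_exists Gc x y.
have := smin (x :: q); rewrite -lq => /(_ (geo_shortest gq).1).
have /andP[_ /eqP sq] := gq.
by rewrite /geo xp eqn_leq dist_le //= lp ltnS sq lq => ->.
Qed.

Lemma ipc_coverable v k x p : ipc v <= k -> geo x p ->
  coverable v k [set u in x :: p].
Proof.
move=> vk gp; have [cov _] := ipcP v Gc.
have [|Q [rQ cQ]] := cov (x :: p).
  by exists x, (last x p); apply: geo_shortest.
have /choice[q qP] : forall i, exists q, geo v q /\ v :: q =i Q i.
  move=> i; have [z [y [/shortest_geo[r [-> gr <-]]]]] := rQ i.
  case=> ->; first by exists r.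
  (* The root is the last vertex here, so the path is reversed to start at it. *)
  exists (rev (belast z r)); split; first exact: geo_rev.
  by move=> u; rewrite -rev_geo mem_rev.
exists [seq q i | i <- enum 'I_(ipc v)]; split=> [||u].
- by rewrite size_map -cardE card_ord.
- by apply/allP => _ /mapP[i _ ->]; have [] := qP i.
rewrite inE => /cQ[i ui]; exists (q i); first by rewrite map_f // mem_enum.
by have [_ ->] := qP i.
Qed.

Lemma coverable_ipc v k :
  (forall x p, geo x p -> coverable v k [set u in x :: p]) -> ipc v <= k.
Proof.
move=> cov; have [_ ipc_min] := ipcP v Gc; apply: ipc_min => P.
case=> x [y /shortest_geo[p [-> gp _]]].
have [Q [sQ /allP gQ cQ]] := cov x p gp.
(* If [Q] has fewer than [k] members, the surplus indices get the one-vertex path at [v]. *)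
exists (fun i => v :: nth [::] Q i); split=> [i|u up].
  exists v, (last v (nth [::] Q i)); split; last by left.
  apply: geo_shortest; have [iQ|iQ] := ltnP i (size Q).
    exact/gQ/mem_nth.
  by rewrite nth_default // geo_nil.
have [|q qQ uq] := cQ u; first by rewrite inE.
have iQ : index q Q < k by apply: leq_trans sQ; rewrite index_mem.
by exists (Ordinal iQ); rewrite nth_index.
Qed.

(** This is the tree with a single piece: [M] is the whole vertex set, every clique serves as its
    own separator, and all branches are empty. *)
Lemma has_medians_of_sipc k : sipc G <= k -> has_medians k G.
Proof.
move=> Gk K cK; exists setT; split=> [c x p _ gp _|Q cQ].
  by apply: ipc_coverable gp; move/bigmax_leqP: Gk => ->.
exists Q, set0; split=> //.
- by split=> // a b; rewrite inE.
- by rewrite set0U.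
- by rewrite -setI_eq0 set0I.
by exists ord0 => i _; rewrite -setI_eq0 set0I.
Qed.
End ShortestPaths.

(** * Clique-sums as unions of two embedded graphs *)

(** A form of the clique-sum without quotient map, in which the summands play symmetric roles. *)
Definition graph_union (A B G : sgraph) (f : A -> G) (g : B -> G) : Prop :=
  [/\ injective f, injective g, forall a b, adj (f a) (f b) = adj a b
    & forall a b, adj (g a) (g b) = adj a b] /\
  [/\ f @: setT :|: g @: setT = setT, clique (f @: setT :&: g @: setT),
      f @: setT :&: g @: setT != set0
    & forall u v, adj u v ->
        (u \in f @: setT) && (v \in f @: setT) ||
        (u \in g @: setT) && (v \in g @: setT)].

Lemma graph_unionC (A B G : sgraph) (f : A -> G) (g : B -> G) :
  graph_union f g -> graph_union g f.
Proof.
case=> [[fI gI fA gA] [cov cS S0 eS]]; split; split=> //.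
- by rewrite setUC.
- by rewrite setIC.
- by rewrite setIC.
by move=> u v /eS; rewrite orbC.
Qed.

Lemma clique_sum_union (A B G : sgraph) : clique_sum A B G ->
  exists (f : A -> G) (g : B -> G), graph_union f g.
Proof.
move=> [CA [CB [phi [q [[cA cB CA0] [[phiI phiE] [qs qi qe]]]]]]].
have adjG z w : disjoint_adj z w -> adj (q z) (q w).
  by move=> zw; apply/qe; exists z, w.
have memS u : u \in (q \o inl) @: setT :&: (q \o inr) @: setT ->
    exists2 a, a \in CA & u = q (inl a).
  rewrite inE => /andP[/imsetP[a _ ->]] /imsetP[b _] /qi[aA _].
  by exists a.
exists (q \o inl), (q \o inr); split; split.
- by move=> a a' /qi /= [].
- by move=> b b' /qi /= [].
- move=> a a'; apply/idP/idP => [/qe[z [w []]]|aa']; last exact: adjG.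
  case: z w => [c|c] [d|d] // /qi /= cE /qi /= dE cd.
    by case: cE dE cd => -> [->].
  (* The edge comes from [B] and joins two identified vertices; the matching edge of [A] exists
     since [CA] is a clique. *)
  case: cE dE cd => [aC ->] [aC' ->] cd; apply: cA => //.
  by apply: contraTneq cd => ->; rewrite adj_irrefl.
- move=> b b'; apply/idP/idP => [/qe[z [w []]]|bb']; last exact: adjG.
  case: z w => [c|c] [d|d] // /qi /= cE /qi /= dE cd; last first.
    by case: cE dE cd => -> [->].
  case: cE dE => [cC ->] [dC ->]; apply: cB; rewrite -?phiE ?imset_f //.
  apply: contraTneq cd => /phiI->; rewrite ?adj_irrefl //.
- apply/setP => u; rewrite !inE; have [[a|b] <-] := qs u.
    by rewrite (imset_f (q \o inl)).
  by rewrite (imset_f (q \o inr)) ?orbT.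
- move=> u v /memS[a aA ->] /memS[b bA ->] nab; apply: adjG; apply: cA => //.
  by apply: contraNneq nab => ->.
- case/card_gt0P: CA0 => a aA; apply/set0Pn; exists (q (inl a)).
  rewrite inE (imset_f (q \o inl)) //=; apply/imsetP; exists (phi a) => //=.
  exact/qi.
move=> u v /qe[[a|a] [[b|b] [<- <- //]]] _.
  by rewrite !(imset_f (q \o inl)).
by rewrite !(imset_f (q \o inr)) ?orbT.
Qed.

Lemma dist_weak_hom (G H : sgraph) (h : G -> H) :
  graph_connected G -> graph_connected H ->
  (forall u v, adj u v -> h u = h v \/ adj (h u) (h v)) ->
  forall u v, dist (h u) (h v) <= dist u v.
Proof.
move=> Gc Hc hom u v; have [p /andP[up /eqP sp] lp] := geo_exists Gc u v.
rewrite -lp -sp; elim: p u up {v sp lp} => [|w p IHp] u /=; first by rewrite dist_self.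
case/andP=> uw /IHp le_p; apply: leq_trans (dist_triangle Hc _ (h w) _) _.
rewrite -add1n leq_add //; have [->|/dist_adj//] := hom u w uw.
by rewrite dist_self.
Qed.

(** * Medians survive a clique-sum *)

Section Union.
Variables (A B G : sgraph) (f : A -> G) (g : B -> G).
Hypotheses (Ac : graph_connected A) (Gc : graph_connected G).
Hypothesis fg : graph_union f g.

Let VA := f @: setT.
Let VB := g @: setT.
Let S := VA :&: VB.

Let fI : injective f. Proof. by case: fg => [[]]. Qed.
Let fA a b : adj (f a) (f b) = adj a b. Proof. by case: fg => [[]]. Qed.
Let cS : clique S. Proof. by case: fg => _ []. Qed.
Let edges u v : adj u v ->
  (u \in VA) && (v \in VA) || (u \in VB) && (v \in VB).
Proof. by case: fg => _ [_ _ _]; apply. Qed.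
Let covered u : (u \in VA) || (u \in VB).
Proof. by have := in_setT u; case: fg => _ [<- _ _ _]; rewrite inE. Qed.
Let fVA a : f a \in VA. Proof. exact: imset_f. Qed.

(* Sending all vertices outside [A] to one vertex of the shared clique maps
   every edge to an edge or to a single vertex, hence does not increase
   distances. *)
Lemma dist_union a b : dist (f a) (f b) = dist a b.
Proof.
have [s0] : exists s, f s \in S.
  case: fg => _ [_ _ /set0Pn[s sS] _]; have := sS.
  rewrite inE => /andP[/imsetP[c _ sE] _].
  by exists c; rewrite -sE.
move=> s0S; pose r u := if [pick c | f c == u] is Some c then c else s0.
have rf c : r (f c) = c.
  by rewrite /r; case: pickP => [d /eqP/fI//|/(_ c)]; rewrite eqxx.
have rN u : u \notin VA -> r u = s0.
  rewrite /r; case: pickP => // c /eqP<-; by rewrite fVA.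
apply/eqP; rewrite eqn_leq; apply/andP; split.
  by apply: dist_weak_hom => // u v uv; right; rewrite fA.
rewrite -{1}[a]rf -{1}[b]rf; apply: dist_weak_hom => // u v uv.
wlog uA : u v uv / u \in VA => [wl|].
  have [uA|uA] := boolP (u \in VA); first exact: wl.
  have [vA|vA] := boolP (v \in VA); last by left; rewrite !rN.
  by rewrite adj_sym; have [|//|->|] := wl v u; [rewrite adj_sym|left|right].
have [vA|vA] := boolP (v \in VA).
  by case/imsetP: uA uv => c _ ->; case/imsetP: vA => d _ ->; rewrite !rf fA; right.
have uS : u \in S.
  by have := edges uv; rewrite (negPf vA) andbF /= inE uA => /andP[->].
rewrite (rN v) //; case/imsetP: uA uS => c _ -> cS'; rewrite rf.
have [->|ncs] := eqVneq c s0; first by left.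
by right; rewrite -fA; apply: cS; rewrite ?inj_eq.
Qed.

Lemma geo_union a p : geo (f a) (map f p) = geo a p.
Proof.
by rewrite /geo path_map last_map size_map dist_union (eq_path (e' := @adj A)).
Qed.

Lemma piece_union k (M : {set A}) : piece k M -> piece k (f @: M).
Proof.
move=> pM _ x p /imsetP[c cM ->] gp sM.
have [s sE sM'] : exists2 s, x :: p = map f s & {subset s <= M}.
  elim: (x :: p) sM => [|y s IHs] sM; first by exists [::].
  have [|t -> tM] := IHs; first by move=> z zs; apply: sM; rewrite inE zs orbT.
  have /imsetP[b bM ->] := sM y (mem_head _ _).
  by exists (b :: t) => // z; rewrite inE => /orP[/eqP->|/tM].
case: s sE sM' => [//|a s] [xE pE] sM'; rewrite {}xE {}pE {x p sM} geo_union in gp *.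
have [Q [sQ gQ cQ]] := pM c a s cM gp sM'.
exists [seq map f q | q <- Q]; split=> [||u].
- by rewrite size_map.
- by rewrite all_map; apply: sub_all gQ => q /=; rewrite geo_union.
rewrite inE -map_cons => /mapP[b bs ->].
have [|q qQ bq] := cQ b; first by rewrite inE.
by exists (map f q); [apply: map_f | rewrite -map_cons map_f].
Qed.

Lemma clique_union_cases (Q : {set G}) :
  clique Q -> (Q \subset VA) || (Q \subset VB).
Proof.
move=> cQ; apply/norP => -[/subsetPn[u uQ uA] /subsetPn[v vQ vB]].
have /edges : adj u v; last by rewrite (negPf uA) (negPf vB) andbF.
apply: cQ => //; apply: contraNneq vB => <-.
by have := covered u; rewrite (negPf uA).
Qed.

Lemma clique_preimset (Q : {set G}) : clique Q -> clique (f @^-1: Q).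
Proof. by move=> cQ a b; rewrite !inE -fA -(inj_eq fI) => /cQ; apply. Qed.

Lemma imset_preimset (Q : {set G}) : Q \subset VA -> f @: (f @^-1: Q) = Q.
Proof.
move/subsetP=> QA; apply/setP => u; apply/imsetP/idP => [[a + ->]|uQ].
  by rewrite inE.
by have /imsetP[a _ uE] := QA u uQ; exists a; rewrite // inE -uE.
Qed.

(** At least two of the cliques lie in [A], and a median found in [A] serves in [G]. A branch that
    misses [S] is kept as it is; one that meets [S] absorbs the whole complement of [VA]. *)
Lemma medians_union k (K : 'I_3 -> {set G}) : has_medians k A ->
  (forall i, clique (K i)) -> (exists j, forall i, i != j -> K i \subset VA) ->
  exists M, median k K M.
Proof.
move=> medA cK [j0 j0P].
pose K' i := if K i \subset VA then K i else S.
have K'A i : K' i \subset VA by rewrite /K'; case: ifP => // _; apply: subsetIl.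
have cK' i : clique (f @^-1: K' i).
  by apply: clique_preimset; rewrite /K'; case: ifP.
have [M0 [/piece_union pM sepM]] := medA _ cK'.
exists (f @: M0); split=> // Q cQ; set M := f @: M0 in pM *.
have MA : M \subset VA by apply: imsetS; apply: subsetT.
(* The separation found in [A], transported to [G]; so far only edges within [VA] are controlled. *)
have sepA (R : {set G}) : clique R -> R \subset VA -> exists C U : {set G},
    [/\ clique C, U \subset VA
      & forall a b, a \in U -> b \in VA -> adj a b -> b \in U :|: C] /\
    [/\ C \subset M, R \subset U :|: C, [disjoint U & M]
      & exists i0, forall i, i != i0 -> [disjoint U & K' i]].
  move=> cR RA.
  have [C [U [[cC bU] CM RU UM [i0 Ui0]]]] := sepM _ (clique_preimset cR).
  exists (f @: C), (f @: U); split; split.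
  - move=> _ _ /imsetP[a aC ->] /imsetP[b bC ->].
    by rewrite inj_eq // fA; apply: cC.
  - exact/imsetS/subsetT.
  - move=> _ _ /imsetP[a aU ->] /imsetP[b _ ->]; rewrite fA -imsetU => ab.
    by rewrite imset_f // (bU a).
  - exact: imsetS.
  - by rewrite -imsetU -(imset_preimset RA) imsetS.
  - by rewrite imset_disjoint.
  exists i0 => i /Ui0; rewrite -{2}(imset_preimset (K'A i)) => dis.
  by rewrite imset_disjoint.
have outside a b : a \notin VA -> adj a b -> b \in VA -> b \in S.
  by move=> aA /edges; rewrite (negPf aA) /= inE => /andP[_ ->] ->.
have joined (C U : {set G}) : clique C -> S \subset U :|: C ->
    (forall a b, a \in U -> b \in VA -> adj a b -> b \in U :|: C) ->
    barrier C (U :|: ~: VA).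
  move=> cC /subsetP SUC bU; split=> // a b aUW ab.
  rewrite setUAC inE; have [bA|bA] := boolP (b \in VA); last by rewrite in_setC bA orbT.
  case/setUP: aUW => [aU|]; first by rewrite (bU a).
  by rewrite inE => aA; rewrite SUC // (outside a).
have joined_dis (U X : {set G}) : X \subset VA -> [disjoint U & X] ->
    [disjoint U :|: ~: VA & X].
  move=> XA UX; rewrite -setI_eq0 setIUl setU_eq0 !setI_eq0 UX.
  by rewrite disjoint_sym disjoints_subset setCK.
have meets (C U : {set G}) :
    (forall a b, a \in U -> b \in VA -> adj a b -> b \in U :|: C) ->
    ~~ [disjoint S & U] -> S \subset U :|: C.
  move=> bU /pred0Pn[s /andP[/= sS sU]]; apply/subsetP => t tS.
  have [<-|nst] := eqVneq s t; first by rewrite inE sU.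
  by apply: (bU s) => //; [have /setIP[] := tS | apply: cS].
(* Since [U] meets [S], avoiding [K' i] means that [K i] was not replaced by [S], hence lies in
   [VA]. *)
have meets_dis (U : {set G}) i : ~~ [disjoint S & U] -> [disjoint U & K' i] ->
    [disjoint U :|: ~: VA & K i].
  move=> SU UK; rewrite /K' in UK; case: ifP UK => [KA|_].
    exact: joined_dis.
  by rewrite disjoint_sym (negPf SU).
have [QA|QA] := boolP (Q \subset VA).
  have [C [U [[cC UA bU] [CM QU UM [i0 Ui0]]]]] := sepA Q cQ QA.
  have [SU|SU] := boolP [disjoint S & U].
    exists C, U; split=> //.
      split=> // a b aU ab; have [bA|bA] := boolP (b \in VA); first exact: bU ab.
      have aS : a \in S.
        by apply: (outside b) => //; [rewrite adj_sym | apply: (subsetP UA)].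
      by rewrite (disjointFr SU aS) in aU.
    exists i0 => i /Ui0; rewrite /K'; case: ifP => // KA _.
    have /orP[|KB] := clique_union_cases (cK i); first by rewrite KA.
    rewrite disjoint_subset; apply/subsetP => u uU; rewrite inE.
    apply/negP => uK; have uS : u \in S by rewrite inE (subsetP UA) ?(subsetP KB).
    by rewrite (disjointFr SU uS) in uU.
  exists C, (U :|: ~: VA); split=> //.
  - by apply: joined => //; apply: meets.
  - by rewrite setUAC subsetU // QU.
  - exact: joined_dis.
  by exists i0 => i /Ui0; apply: meets_dis.
have QB : Q \subset VB by have := clique_union_cases cQ; rewrite (negPf QA).
(* Seen from [A], a clique on the other side lies where [S] does. *)
have [C [U [[cC UA bU] [CM SUC UM [i0 Ui0]]]]] := sepA S cS (subsetIl _ _).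
have Qsub (U' : {set G}) : S \subset U' :|: C -> Q \subset (U' :|: ~: VA) :|: C.
  move/subsetP=> SUC'; apply/subsetP => u uQ; rewrite setUAC inE.
  have [uA|uA] := boolP (u \in VA); last by rewrite in_setC uA orbT.
  by rewrite SUC' // inE uA (subsetP QB).
have [SU|SU] := boolP [disjoint S & U].
  (* Here [S] lies in [C], so the branch is the complement of [VA] alone, and only the exceptional
     [K j0] can meet it. *)
  have SC : S \subset set0 :|: C.
    rewrite set0U; apply/subsetP => s sS; have := subsetP SUC s sS.
    by rewrite inE (disjointFr SU sS).
  exists C, (set0 :|: ~: VA); split=> //.
  - by apply: joined => // a b; rewrite inE.
  - exact: Qsub.
  - by apply: joined_dis; rewrite // -setI_eq0 set0I.
  by exists j0 => i /j0P KA; apply: joined_dis; rewrite // -setI_eq0 set0I.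
exists C, (U :|: ~: VA); split=> //.
- exact: joined.
- exact: Qsub.
- exact: joined_dis.
by exists i0 => i /Ui0; apply: meets_dis.
Qed.
End Union.

(** Pigeonhole: each of three cliques is on one of two sides, so two share a side, and the median is
    sought there. *)
Lemma majority (a b : pred 'I_3) : (forall i, a i || b i) ->
  (exists j, forall i, i != j -> a i) \/ (exists j, forall i, i != j -> b i).
Proof.
move=> ab.
pose o0 := @Ordinal 3 0 isT; pose o1 := @Ordinal 3 1 isT; pose o2 := @Ordinal 3 2 isT.
have two (c : pred 'I_3) : [|| c o0 && c o1, c o0 && c o2 | c o1 && c o2] ->
    exists j, forall i, i != j -> c i.
  have ord3 i : [|| i == o0, i == o1 | i == o2] by case: i => [[|[|[|]]]].
  case/or3P=> /andP[cl cr]; [exists o2 | exists o1 | exists o0] => i;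
    by have /or3P[] := ord3 i => /eqP->.
suff /orP[/two|/two] : [|| a o0 && a o1, a o0 && a o2 | a o1 && a o2] ||
    [|| b o0 && b o1, b o0 && b o2 | b o1 && b o2] by [left | right].
move: (ab o0) (ab o1) (ab o2).
by case: (a o0); case: (a o1); case: (a o2); case: (b o0); case: (b o1); case: (b o2).
Qed.

Lemma has_medians_clique_sum k (A B G : sgraph) :
  graph_connected A -> graph_connected B -> clique_sum A B G ->
  has_medians k A -> has_medians k B -> has_medians k G.
Proof.
move=> Ac Bc sumG medA medB K cK; have Gc := clique_sum_connected sumG Ac Bc.
have [f [g fg]] := clique_sum_union sumG.
have /majority[KA|KB] i := clique_union_cases fg (cK i).
  exact: (medians_union Ac Gc fg).
exact: (medians_union Bc Gc (graph_unionC fg)).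
Qed.

(** * The bound for a graph with medians *)

Section Bound.
Variables (G : sgraph) (k : nat).
Hypotheses (Gc : graph_connected G) (medG : has_medians k G).

Lemma piece_coverable (M : {set G}) v x p : piece k M ->
  (forall u, exists C U,
    [/\ barrier C U, C \subset M, u \in U :|: C & [disjoint U & M]]) ->
  geo x p -> coverable v (2 * k) [set u in x :: p | u \in M].
Proof.
move=> pM sepM gp.
have XP z : z \in [set u in x :: p | u \in M] = (z \in x :: p) && (z \in M).
  by rewrite !inE.
set X := [set u in _ | _] in XP *.
have [->|[u0 u0X]] := set_0Vmem X.
  exact: coverableW (sub0set _) (coverable0 v).
case: (arg_minnP (dist x) u0X) => u uX umin.
case: (arg_maxnP (dist x) u0X) => w wX wmax.
have /andP[up uM] : (u \in x :: p) && (u \in M) by rewrite -XP; exact: uX.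
have /andP[wp wM] : (w \in x :: p) && (w \in M) by rewrite -XP; exact: wX.
have [[lu Pu] [lw Pw]] := (geo_index Gc gp up, geo_index Gc gp wp).
have uw : dist x u <= dist x w := wmax _ uX.
have ijp : dist x u <= dist x w <= size p by rewrite uw.
have gs := geo_segment Gc gp ijp; rewrite Pu in gs.
set s := segment p _ _ in gs.
(* A vertex of the segment outside [M] would lie in a branch that the path enters and leaves again,
   against [barrier_convex]. *)
have sM : {subset u :: s <= M}.
  move=> z zs; apply: contraT => zM.
  have [|l lij zE] := segment_mem gp ijp (u := z); first by rewrite Pu.
  have lp : l <= size p by case/andP: lij => _ le_lw; apply: leq_trans le_lw lw.
  have dz : dist x z = l.
    by have := dist_geo Gc gp (i := 0) (j := l) lp; rewrite /= subn0 -zE.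
  have zp : z \in x :: p by rewrite zE; apply: mem_nth.
  have [C [U [bCU /subsetP CM zUC UM]]] := sepM z.
  have zC : z \notin C by apply: contra zM => /CM.
  have zU : z \in U by move: zUC; rewrite inE (negPf zC) orbF.
  case: (barrier_convex Gc bCU gp up zp wp _ _ zU zC _); first by rewrite dz.
    by rewrite (disjointFl UM uM).
  by rewrite (disjointFl UM wM).
have [C [U [bCU /subsetP CM vUC UM]]] := sepM v.
have offU z : z \in M -> z \notin U by move=> zM; rewrite (disjointFl UM zM).
have [c0 c0C _] := dist_barrier Gc bCU vUC (offU u uM).
case: (arg_minnP (dist v) c0C) => c cC cmin.
have [Q [sQ /allP gQ cQ]] := pM c u s (CM c cC) gs sM.
apply: (@coverableW _ v (2 * size Q) _ _
          (\bigcup_(q <- Q) [set z in c :: q | z \in M])); first by rewrite leq_mul2l.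
  apply/subsetP => z zX; have := zX; rewrite XP => /andP[zp zM].
  have zs : z \in u :: s.
    have := mem_segment gp (i := dist x u) (j := dist x w) (l := dist x z).
    rewrite umin // [_ <= dist x w]wmax // Pu => /(_ isT lw).
    by have [_ ->] := geo_index Gc gp zp.
  have [|q qQ zq] := cQ z; first by rewrite inE.
  by rewrite (big_rem _ qQ) /= inE inE zq zM.
apply: coverable_bigU => q /gQ gq; apply: (chain_coverable Gc gq) => [z|y z].
  by rewrite inE => /andP[].
rewrite !inE => /andP[_ yM] /andP[_ zM] _.
(* A geodesic from [v] to [z] passes through some [d] in [C]; [dist v c <= dist v d] and
   [dist c d <= 1] leave a defect of at most 1. *)
have [d dC ->] := dist_barrier Gc bCU vUC (offU z zM).
move: (cmin d dC) (dist_clique bCU.1 cC dC).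
by move: (dist_triangle Gc v c y) (dist_triangle Gc c d z); clear; lia.
Qed.

Lemma geodesic_coverable (v x : G) p :
  geo x p -> coverable v (2 * k + 6) [set u in x :: p].
Proof.
move=> gp; set y := last x p; have /andP[_ /eqP sp] := gp.
have [xp yp] : x \in x :: p /\ y \in x :: p by rewrite mem_head mem_last.
pose ends := tnth [tuple v; x; y].
(* The three vertices enter as one-element cliques. *)
have [|M [pM sepM]] := medG (K := fun i => [set ends i]).
  by move=> i a b; rewrite !inE => /eqP-> /eqP->; rewrite eqxx.
have c1 (u : G) : clique [set u].
  by move=> a b; rewrite !inE => /eqP-> /eqP->; rewrite eqxx.
pose X z := [set u in x :: p | `[< exists K U,
  [/\ barrier K U, u \in U, u \notin K, z \notin U & v \notin U] >]].
have X3 : coverable v 3 (X x).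
  apply: (branch_coverable Gc gp) => [u|u]; first by rewrite inE => /andP[].
  by rewrite inE => /andP[_ /asboolP].
have X1 : coverable v 3 (X y).
  (* Reversing [p] puts [y] at the start. *)
  apply: (branch_coverable Gc (geo_rev Gc gp)) => [u|u].
    by rewrite -rev_geo mem_rev inE => /andP[].
  by rewrite inE => /andP[_ /asboolP].
have X2 : coverable v (2 * k) [set u in x :: p | u \in M].
  apply: piece_coverable => // u; have [C [U [bCU CM uUC UM _]]] := sepM _ (c1 u).
  by exists C, U; rewrite -sub1set.
apply: coverableW (coverableU X2 (coverableU X1 X3)) => //.
apply/subsetP => u; rewrite in_set => up; rewrite !in_setU !in_set up /=.
have [//|uM] := boolP (u \in M).
have [C [U [bCU /subsetP CM uUC UM [i0 Ui0]]]] := sepM _ (c1 u).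
have uC : u \notin C by apply: contra uM => /CM.
have uU : u \in U by move: uUC; rewrite sub1set inE (negPf uC) orbF.
have offU i : i != i0 -> ends i \notin U.
  by move/Ui0; rewrite disjoint_sym disjoints1.
have ends3 j : i0 != j -> ends j \notin U by rewrite eq_sym; apply: offU.
(* [i0] indicates which one of [v], [x], [y] the branch of [u] may contain. The case of [v]
   contradicts convexity; for [x] the vertex [u] is in [X y], and for [y] it is in [X x]. *)
case: i0 ends3 {Ui0 offU} => [[|[|[|//]]] i3] ends3.
- have := ends3 (@Ordinal 3 1 isT) isT; have := ends3 (@Ordinal 3 2 isT) isT.
  rewrite /ends !(tnth_nth v) /= => yU xU.
  case: (barrier_convex Gc bCU gp xp up yp _ xU uU uC yU).
  by rewrite dist_self /= -sp; have [] := geo_index Gc gp up.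
- have := ends3 (@Ordinal 3 0 isT) isT; have := ends3 (@Ordinal 3 2 isT) isT.
  rewrite /ends !(tnth_nth v) /= => yU vU.
  by apply/orP; left; apply/asboolP; exists C, U.
have := ends3 (@Ordinal 3 0 isT) isT; have := ends3 (@Ordinal 3 1 isT) isT.
rewrite /ends !(tnth_nth v) /= => xU vU.
by apply/orP; right; apply/asboolP; exists C, U.
Qed.

Lemma sipc_has_medians : sipc G <= 2 * k + 6.
Proof.
apply/bigmax_leqP => v _; apply: coverable_ipc => // x p gp.
exact: geodesic_coverable.
Qed.
End Bound.

(** * Induction along the clique-sums *)

Lemma iterated_clique_sum_closed (P : sgraph -> Prop) s G :
  (forall A B C, P A -> P B -> clique_sum A B C -> P C) ->
  iterated_clique_sum s G -> all (fun H => `[< P H >]) s -> P G.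
Proof.
move=> Psum; elim=> {s G} [G|s1 A s2 B s3 C G sumC _ IH].
  by rewrite /= andbT => /asboolP.
rewrite all_cat /= all_cat /= => /and3P[P1 /asboolP PA /and3P[P2 /asboolP PB P3]].
by apply: IH; rewrite /= !all_cat P1 P2 P3 !andbT; apply/asboolP/(Psum A B).
Qed.

Lemma iterated_clique_sum_size s G : iterated_clique_sum s G -> 0 < size s.
Proof. by case=> // s1 A s2 B s3 C {}G _ _; rewrite size_cat addnS. Qed.

Theorem theorem1p9 (k : int) (t : nat) (Gs : 'I_t -> sgraph) (G : sgraph)
    (Gs_connected : forall i, graph_connected (Gs i))
    (Gs_sipc : forall i, ((sipc (Gs i))%:Z <= k)%R)
    (G_sum : iterated_clique_sum [seq Gs i | i : 'I_t] G) :
  ((sipc G)%:Z <= 3 * k + 18)%R.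
Proof.
(* A negative [k] is impossible, as the collection is nonempty and [sipc] is a natural number. *)
case: k Gs_sipc => [k|k] Gs_sipc; last first.
  have := iterated_clique_sum_size G_sum; rewrite size_image card_ord.
  by case: t Gs Gs_sipc {Gs_connected G_sum} => // t Gs /(_ ord0).
have [Gc medG] : graph_connected G /\ has_medians k G.
  pose P H := graph_connected H /\ has_medians k H.
  apply: (@iterated_clique_sum_closed P _ _ _ G_sum).
    move=> A B C [Ac mA] [Bc mB] sumC.
    split; first exact: clique_sum_connected sumC _ _.
    by apply: has_medians_clique_sum sumC _ _.
  rewrite all_map; apply/allP => i _; apply/asboolP; split=> //.
  by apply: has_medians_of_sipc => //; have := Gs_sipc i.
have := sipc_has_medians Gc medG; lia.
Qed.
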